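(* Let $q$ be a prime power. Let $L$ be an $\mathbb{F}_q$-linear set of rank $n$ in $\Lambda=\mathrm{PG}(r-1,q^t)$ with $\langle L\rangle=\mathrm{PG}(r-1,q^t)$, and suppose that $(L,n)$ does not satisfy condition (A) (as defined in the context). Then in $\mathrm{PG}(n-1,q^t)\supset\Lambda$ there are an $(n-1-r)$-subspace $\Gamma$ disjoint from $\Lambda$ and two $q$-order canonical subgeometries $\Sigma_1,\Sigma_2\subset\mathrm{PG}(n-1,q^t)\setminus\Gamma$ such that $$L=p_{\Gamma,\Lambda}(\Sigma_1)=p_{\Gamma,\Lambda}(\Sigma_2),$$ and such that there exists no collineation $\beta$ of $\mathrm{PG}(n-1,q^t)$ with $\Sigma_1^{\beta}=\Sigma_2$ and $\Gamma^{\beta}=\Gamma$.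
   Context: For a vector space $V$ over a finite field $F$, the points of the associated projective space are the one-dimensional $F$-subspaces of $V$; $\mathrm{PG}_{q^t}(V)$ and $\mathrm{PG}_q(V)$ indicate over which field $V$ is considered, and $\langle v\rangle_{q^t}$ denotes the point spanned by $v\ne0$ over $\mathbb{F}_{q^t}$. For a point set $T$, $\langle T\rangle$ is the projective subspace it spans. All dimensions of projective subspaces are projective dimensions (the empty subspace has dimension $-1$). A collineation is a bijection of points induced by an invertible semilinear map of the underlying vector space. Canonical subgeometry: let $V$ be an $n$-dimensional vector space over $\mathbb{F}_{q^t}$ and let $W\subset V$ be an $\mathbb{F}_q$-subspace with $\dim_{\mathbb{F}_q}W=n$ whose $\mathbb{F}_{q^t}$-span is $V$. Then $\{\langle w\rangle_{q^t}: w\in W\setminus\{0\}\}$ is a ($q$-order) canonical subgeometry of $\mathrm{PG}(n-1,q^t)$; it is isomorphic to $\mathrm{PG}(n-1,q)$. Projection: if $\Sigma'$ is a canonical subgeometry of $\Sigma^*=\mathrm{PG}(n-1,q^t)$, $\Gamma\subset\Sigma^*\setminus\Sigma'$ is an $(n-1-r)$-subspace, and $\Lambda\subset\Sigma^*\setminus\Gamma$ is an $(r-1)$-subspace, then $p_{\Gamma,\Lambda}(\Sigma')=\{\langle\Gamma,P\rangle\cap\Lambda: P\in\Sigma'\}$. Field reduction and linear sets: let $R$ be an $r$-dimensional vector space over $\mathbb{F}_{q^t}$. The field reduction map $\mathcal{F}_{r,t,q}$ sends a point $P=\mathrm{PG}_{q^t}(T)$ of $\mathrm{PG}_{q^t}(R)=\mathrm{PG}(r-1,q^t)$,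 where $T$ is a one-dimensional $\mathbb{F}_{q^t}$-subspace of $R$, to the $(t-1)$-subspace $\mathrm{PG}_q(T)$ of $\mathrm{PG}_q(R)=\mathrm{PG}(rt-1,q)$. With $\mathcal{P}$ the point set of $\mathrm{PG}(r-1,q^t)$, the image $\mathcal{F}_{r,t,q}(\mathcal{P})$ is a partition of the points of $\mathrm{PG}(rt-1,q)$ (a Desarguesian spread). For a subspace $S$ of $\mathrm{PG}(rt-1,q)$, put $\mathcal{B}(S)=\{P\in\mathrm{PG}(r-1,q^t):\mathcal{F}_{r,t,q}(P)\cap S\ne\emptyset\}$. A set $L\subseteq\mathrm{PG}(r-1,q^t)$ is an $\mathbb{F}_q$-linear set of rank $n$ if $L=\mathcal{B}(S)$ for some $(n-1)$-subspace $S$ of $\mathrm{PG}(rt-1,q)$. Condition (A): for a linear set $L$ of rank $n$ in $\mathrm{PG}(r-1,q^t)$, the pair $(L,n)$ satisfies condition (A) if for any two $(n-1)$-subspaces $U,U'\subset\mathrm{PG}(rt-1,q)$ with $\mathcal{B}(U)=L=\mathcal{B}(U')$ there exists a collineation $\gamma\in\mathrm{P\Gamma L}(rt,q)$ such that $U^{\gamma}=U'$, $\gamma$ preserves the Desarguesian spread $\mathcal{F}_{r,t,q}(\mathcal{P})$, and the map induced by $\gamma$ on $\mathrm{PG}(r-1,q^t)$ is a collineation. *)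

(* Defs.v *)
From HB Require Import structures.
From mathcomp Require Import all_boot all_order all_algebra all_field.
From mathcomp Require Import all_classical.

Set Implicit Arguments.
Unset Strict Implicit.
Unset Printing Implicit Defensive.

Import GRing.Theory.
Local Open Scope classical_set_scope.
Local Open Scope ring_scope.

(* All dimensions below are vector-space dimensions: a subspace U of V stands
   for the projective subspace of projective dimension \dim U - 1, so that the
   empty projective subspace is 0%VS. *)

Section ProjectiveSpace.

Variables (k : fieldType) (V : vectType k).

Definition pgpoint := {P : {vspace V} | \dim P == 1%N}.

Definition PG (U : {vspace V}) : set pgpoint := [set P | (val P <= U)%VS].

Definition pspan (T : set pgpoint) : set pgpoint :=
  \bigcap_(U in [set U : {vspace V} | T `<=` PG U]) PG U.

(* Since f is bijective and val P, val (b P) are lines, the last clause says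
   val (b P) = f (val P). *)
Definition collineation (b : pgpoint -> pgpoint) : Prop :=
  exists (s : {rmorphism k -> k}) (f : V -> V),
    [/\ bijective s, bijective f,
        {morph f : u v / u + v},
        (forall a v, f (a *: v) = s a *: f v) &
        forall (P : pgpoint) v, v \in val P -> f v \in val (b P)].

End ProjectiveSpace.

Section RestrictionOfScalars.

Variables (F : fieldType) (K : fieldExtType F) (V : vectType K).

Definition restr : Type := V.

HB.instance Definition _ := GRing.Zmodule.on restr.

Definition restr_scale (a : F) (v : restr) : restr := a%:A *: (v : V).

Fact restr_scaleA a b v :
  restr_scale a (restr_scale b v) = restr_scale (a * b) v.
Proof. by rewrite /restr_scale scalerA -(rmorphM (in_alg K)). Qed.

Fact restr_scale1 v : restr_scale 1 v = v.
Proof. by rewrite /restr_scale !scale1r. Qed.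

Fact restr_scaleDr a u v :
  restr_scale a (u + v) = restr_scale a u + restr_scale a v.
Proof. exact: scalerDr. Qed.

Fact restr_scaleDl v a b :
  restr_scale (a + b) v = restr_scale a v + restr_scale b v.
Proof. by rewrite /restr_scale -scalerDl -(rmorphD (in_alg K)). Qed.

HB.instance Definition _ := GRing.Zmodule_isLmodule.Build F restr
  restr_scaleA restr_scale1 restr_scaleDr restr_scaleDl.

Lemma restr_scaleE (a : F) (v : V) : a *: (v : restr) = a%:A *: v.
Proof. by []. Qed.

Fact restr_vectMixin : Lmodule_hasFinDim F restr.
Proof.
pose bK := vbasis {:K}; set n := \dim {:K} in bK.
pose bV := vbasis {:V}; set m := \dim {:V} in bV.
pose v2r (x : restr) := mxvec (\matrix_(i, j) coord bK j (coord bV i x)).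
have v2r_lin: linear v2r.
  move=> a x y; rewrite -linearP; congr mxvec; apply/matrixP=> i j.
  by rewrite !mxE linearP /= mulr_algl linearP.
pose r2v r : V := \sum_(i < m) (\sum_(j < n) vec_mx r i j *: bK`_j) *: bV`_i.
have v2rK: cancel v2r r2v.
  move=> x; transitivity (\sum_(i < m) coord bV i x *: bV`_i); last first.
    by rewrite -coord_vbasis ?memvf.
  apply: eq_bigr => i _; rewrite mxvecK; congr (_ *: _ : V).
  rewrite (coord_vbasis (memvf (coord bV i x))).
  by apply: eq_bigr => j _; rewrite mxE.
exists (m * n)%N, v2r => //; exists r2v => // r.
apply: (canLR vec_mxK); apply/matrixP=> i j; rewrite mxE.
by rewrite !coord_sum_free ?(basis_free (vbasisP _)).
Qed.

HB.instance Definition _ := restr_vectMixin.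

(* U seen as a vector space over F, built as the image of an F-linear
   projection onto U; see mem_restrv. *)
Definition restrv (U : {vspace V}) : {vspace restr} :=
  limg (linfun (projv U : restr -> restr)).

Lemma mem_restrv U (v : V) : ((v : restr) \in restrv U) = (v \in U).
Proof.
have lin_p : linear (projv U : restr -> restr).
  by move=> a x y; rewrite restr_scaleE linearP.
pose pM := GRing.isLinear.Build _ _ _ _ (projv U : restr -> restr) lin_p.
pose p : {linear restr -> restr} := HB.pack (projv U : restr -> restr) pM.
have fE : linfun (projv U : restr -> restr) =1 projv U.
  by move=> x; rewrite (lfunE p).
apply/idP/idP => [/memv_imgP[x _ ->]|Uv].
  by rewrite fE memv_proj.
by rewrite -(projv_id Uv) -fE memv_img ?memvf.
Qed.

Definition Kspan (W : {vspace restr}) : {vspace V} :=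
  <<(vbasis W : seq V)>>%VS.

Lemma Kspan_subv W U : (Kspan W <= U)%VS = (W <= restrv U)%VS.
Proof.
apply/span_subvP/idP => [WU|/subvP WU v Wv]; last first.
  by rewrite -mem_restrv WU ?vbasis_mem.
rewrite -(span_basis (vbasisP W)); apply/span_subvP => v Wv.
by rewrite mem_restrv WU.
Qed.

End RestrictionOfScalars.

Section LinearSets.

Variables (F : fieldType) (K : fieldExtType F) (R : vectType K).

Definition field_reduction (P : pgpoint R) : {vspace restr R} := restrv (val P).

Definition desarguesian_spread : set (set (pgpoint (restr R))) :=
  [set PG (field_reduction P) | P in [set: pgpoint R]].

Definition calB (S : {vspace restr R}) : set (pgpoint R) :=
  [set P | PG (field_reduction P) `&` PG S !=set0].

Definition linear_set (n : nat) (L : set (pgpoint R)) : Prop :=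
  exists S : {vspace restr R}, \dim S = n /\ L = calB S.

Definition conditionA (n : nat) (L : set (pgpoint R)) : Prop :=
  forall U U' : {vspace restr R},
    \dim U = n -> \dim U' = n -> calB U = L -> calB U' = L ->
  exists gamma : pgpoint (restr R) -> pgpoint (restr R),
    [/\ collineation gamma,
        gamma @` PG U = PG U',
        [set gamma @` D | D in desarguesian_spread] = desarguesian_spread &
        exists2 g : pgpoint R -> pgpoint R, collineation g &
          forall P, gamma @` PG (field_reduction P) = PG (field_reduction (g P))].

End LinearSets.

Section Subgeometries.

Variables (F : fieldType) (K : fieldExtType F) (V : vectType K).

Definition canonical_subgeometry (Sigma : set (pgpoint V)) : Prop :=
  exists W : {vspace restr V},
    [/\ \dim W = \dim {:V}, Kspan W = fullv &
        Sigma = [set P | exists w : V,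
                   [/\ w != 0, (w : restr V) \in W & val P = <[w]>%VS]]].

End Subgeometries.

(* The points of Lam are those of the vector space subvs_of Lam, with inclusion
   vsval into V. *)
Definition projection (K : fieldType) (V : vectType K) (Gam Lam : {vspace V})
    (Sigma : set (pgpoint V)) : set (pgpoint (subvs_of Lam)) :=
  [set Q | exists2 P, Sigma P &
     (linfun vsval @: val Q = (Gam + val P) :&: Lam)%VS].

(* Main.v *)
(* Let U be an n-dimensional F-subspace of Lam with B(U) = L. An F-basis of U
   spans Lam over K, hence lifts, along the projection p from a fixed complement
   Gam, to a K-basis of V; its F-span W defines a canonical subgeometry that
   projects onto L. Do this for U and for U'. A collineation that fixes Gam and
   maps one subgeometry to the other comes from a semilinear map f; after
   rescaling, f maps W onto W', and since it preserves Gam it descends along p to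
   a semilinear map sending U to U'. As its companion automorphism preserves the
   subfield F of K (the roots of X^q - X), this map is also semilinear over F and
   yields the collineation required by condition (A). *)

From HB Require Import structures.
Require Import Defs.
From mathcomp Require Import all_boot all_order all_algebra all_field.
From mathcomp Require Import all_classical.

Set Implicit Arguments.
Unset Strict Implicit.
Unset Printing Implicit Defensive.

Import GRing.Theory.
Local Open Scope classical_set_scope.
Local Open Scope ring_scope.

(** * Semilinear maps and the point maps they induce *)

Section Collineations.

Variables (k : fieldType) (V : vectType k).
Implicit Types (P Q : pgpoint V) (u v w : V) (U : {vspace V}).

Lemma pgpoint_line P v : v \in val P -> v != 0 -> val P = <[v]>%VS.
Proof.
move=> Pv nz_v; apply/eqP; rewrite eq_sym eqEdim -memvE Pv /=.
by rewrite dim_vline nz_v (eqP (valP P)).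
Qed.

Lemma pgpointP P : exists2 v, v != 0 & val P = <[v]>%VS.
Proof.
have nz_v : vpick (val P) != 0.
  by rewrite vpick0 -dimv_eq0 (eqP (valP P)).
by exists (vpick (val P)); rewrite // -(pgpoint_line (memv_pick _)).
Qed.

Lemma line_pgpoint v : v != 0 -> exists P : pgpoint V, val P = <[v]>%VS.
Proof.
move=> nz_v; have dv : \dim <[v]> == 1%N by rewrite dim_vline nz_v.
by exists (exist (fun U : {vspace V} => \dim U == 1%N) _ dv).
Qed.

Lemma PG_subv (U1 U2 : {vspace V}) : PG U1 `<=` PG U2 -> (U1 <= U2)%VS.
Proof.
move=> sU; apply/subvP => v Uv; have [->|nz_v] := eqVneq v 0; first exact: mem0v.
have [P defP] := line_pgpoint nz_v.
by have := sU P; rewrite /PG /= defP -!memvE; apply.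
Qed.

Lemma pspan_full (T : set (pgpoint V)) U :
  pspan T = [set: pgpoint V] -> T `<=` PG U -> U = fullv.
Proof.
move=> spanT sTU; apply/eqP; rewrite eqEsubv subvf /=; apply: PG_subv => P _.
by have: pspan T P by [rewrite spanT]; apply.
Qed.

Definition semilinear (s : k -> k) (f : V -> V) :=
  [/\ bijective s, bijective f, {morph f : u v / u + v} &
      forall a v, f (a *: v) = s a *: f v].

Section Semilinear.

Variables (s : {rmorphism k -> k}) (f : V -> V).
Hypothesis sl_f : semilinear s f.

Lemma semilinear0 : f 0 = 0.
Proof. by case: sl_f => _ _ _ /(_ 0 0); rewrite rmorph0 !scale0r. Qed.

Lemma semilinear_eq0 v : (f v == 0) = (v == 0).
Proof.
by case: sl_f => _ /bij_inj injf _ _; rewrite -{1}semilinear0 (inj_eq injf).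
Qed.

Lemma semilinearB u v : f (u - v) = f u - f v.
Proof.
by case: sl_f => _ _ fD _; apply: (addIr (f v)); rewrite -fD !subrK.
Qed.

Lemma semilinear_sum I r (P : pred I) (F : I -> V) :
  f (\sum_(i <- r | P i) F i) = \sum_(i <- r | P i) f (F i).
Proof. by case: sl_f => _ _ fD _; apply: (big_morph f fD semilinear0). Qed.

Lemma semilinear_line u v : (f u \in <[f v]>%VS) = (u \in <[v]>%VS).
Proof.
case: sl_f => -[s' sK s'K] /bij_inj injf _ fZ.
apply/vlineP/vlineP => [[a fu] | [a ->]]; last by exists (s a).
by exists (s' a); apply: injf; rewrite fZ s'K.
Qed.

Lemma semilinear_scale c : c != 0 -> semilinear s (fun v => c *: f v).
Proof.
case: sl_f => bij_s [f' fK f'K] fD fZ nz_c; split=> //.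
- exists (fun v => f' (c^-1 *: v)) => v; first by rewrite scalerK.
  by rewrite f'K scalerA divff ?scale1r.
- by move=> u v; rewrite fD scalerDr.
by move=> a v; rewrite fZ !scalerA mulrC.
Qed.

Lemma semilinear_induces :
  exists b : pgpoint V -> pgpoint V,
    forall P v, v \in val P -> f v \in val (b P).
Proof.
have Q P : {Q : pgpoint V | forall v, v \in val P -> f v \in val Q}.
  apply: cid; have [v nz_v ->] := pgpointP P.
  have [|Q defQ] := @line_pgpoint (f v); first by rewrite semilinear_eq0.
  by exists Q => u; rewrite defQ semilinear_line.
by exists (fun P => sval (Q P)) => P; apply: (svalP (Q P)).
Qed.

Variable b : pgpoint V -> pgpoint V.
Hypothesis fb : forall P v, v \in val P -> f v \in val (b P).

Lemma induced_collineation : collineation b.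
Proof. by case: sl_f => *; exists s, f. Qed.

Lemma induced_line P v : v != 0 -> val P = <[v]>%VS -> val (b P) = <[f v]>%VS.
Proof.
move=> nz_v defP; apply: pgpoint_line; last by rewrite semilinear_eq0.
by apply: fb; rewrite defP memv_line.
Qed.

Lemma mem_induced P v : (f v \in val (b P)) = (v \in val P).
Proof.
have [u nz_u defP] := pgpointP P.
by rewrite (induced_line nz_u defP) semilinear_line defP.
Qed.

Lemma induced_surj Q : exists P, b P = Q.
Proof.
case: sl_f => _ [f' fK f'K] _ _; have [w nz_w defQ] := pgpointP Q.
have nz_v : f' w != 0 by rewrite -semilinear_eq0 f'K.
have [P defP] := line_pgpoint nz_v; exists P; apply: val_inj.
by rewrite (induced_line nz_v defP) f'K.
Qed.

(** The passage between point sets and vectors: read forwards, it shows that the map behind a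
    collineation preserves the centre; read backwards, it yields clauses of condition (A). *)
Lemma induced_image_PG U1 U2 :
  b @` PG U1 = PG U2 <-> forall v, (f v \in U2) = (v \in U1).
Proof.
split=> [bU v | fU].
  have [->|nz_v] := eqVneq v 0; first by rewrite semilinear0 !mem0v.
  have [P defP] := line_pgpoint nz_v.
  have defbP := induced_line nz_v defP; apply/idP/idP.
    move=> U2fv; have: PG U2 (b P) by rewrite /PG /= defbP -memvE.
    rewrite -bU => -[Q QU eqbPQ].
    suffices: (val P <= U1)%VS by rewrite defP memvE.
    suffices -> : P = Q by [].
    apply: val_inj; rewrite /= defP -(@pgpoint_line Q v) //.
    by rewrite -mem_induced eqbPQ defbP memv_line.
  rewrite memvE -defP => PU; rewrite memvE -defbP.
  by have: PG U2 (b P) by rewrite -bU; exists P.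
apply/seteqP; split=> [_ [P PU <-] | Q QU].
  have [v nz_v defP] := pgpointP P.
  by rewrite /PG /= (induced_line nz_v defP) -memvE fU memvE -defP.
have [P defQ] := induced_surj Q; exists P => //.
have [v nz_v defP] := pgpointP P; move: QU.
by rewrite -defQ /PG /= (induced_line nz_v defP) defP -!memvE fU.
Qed.

End Semilinear.

End Collineations.

(** The copy of [F] in [K] is cut out by x^m = x with m the order of [F], and ring morphisms
    preserve this equation. The restriction is injective on a finite set, hence bijective. *)
Lemma rmorphism_base_field (F : finFieldType) (K : fieldExtType F)
    (s : {rmorphism K -> K}) :
  exists s0 : {rmorphism F -> F},
    bijective s0 /\ forall a : F, s a%:A = (s0 a)%:A.
Proof.
have sF (a : F) : {b : F | s a%:A = b%:A}.
  apply: cid; suffices /vlineP[b sab] : s a%:A \in 1%VS by exists b.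
  rewrite (Fermat's_little_theorem 1%AS) -rmorphXn /=.
  have := Fermat's_little_theorem (1%AS : {subfield K}) a%:A.
  by rewrite rpredZ ?mem1v // => /esym /eqP ->.
pose s0 a := sval (sF a); have s0E a : s a%:A = (s0 a)%:A := svalP (sF a).
have injA : injective (in_alg K) by apply: fmorph_inj.
have s0B : zmod_morphism s0.
  by move=> a b; apply: injA; rewrite /= -s0E scalerBl rmorphB !s0E scalerBl.
have mulA (a b : F) : (a * b)%:A = a%:A * b%:A :> K := rmorphM (in_alg K) a b.
have s0M : monoid_morphism s0.
  split=> [|a b]; first by apply: injA; rewrite /= -s0E scale1r rmorph1.
  by apply: injA; rewrite /= mulA -!s0E mulA rmorphM.
pose sB := GRing.isZmodMorphism.Build _ _ s0 s0B.
pose sM := GRing.isMonoidMorphism.Build _ _ s0 s0M.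
pose s1 : {rmorphism F -> F} := HB.pack s0 sB sM.
by exists s1; split=> //; apply: injF_bij; apply: fmorph_inj.
Qed.

(** The linear map [h] sending e_i to u_i and the map [p] are both onto [R], so their kernels have
    equal dimension. A section of [p] after [h], corrected by a map [k] that identifies the two
    kernels, is an injective [a] whose composite with [p] is [h]; the image of [e] under [a] is the
    basis sought. *)
Lemma lift_basis (K : fieldType) (V R : vectType K) (p : 'Hom(V, R))
    (u : (\dim {:V}).-tuple R) :
  limg p = fullv -> <<u>>%VS = fullv ->
  exists2 w : (\dim {:V}).-tuple V, basis_of fullv w &
    forall i, p w`_i = u`_i.
Proof.
move=> p_surj u_span; pose e := vbasis {:V}.
have e_free : free e := basis_free (vbasisP _).
have h_lin : linear (fun v => \sum_i coord e i v *: u`_i).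
  move=> a x y; rewrite scaler_sumr -big_split; apply: eq_bigr => i _.
  by rewrite linearP scalerDl scalerA.
pose hM := GRing.isLinear.Build _ _ _ _ _ h_lin.
pose h : {linear V -> R} := HB.pack (fun v => \sum_i coord e i v *: u`_i) hM.
have he (i : 'I_(\dim {:V})) : h e`_i = u`_i.
  rewrite /= (bigD1 i) //= coord_free // eqxx scale1r big1 ?addr0 // => j ji.
  by rewrite coord_free // eq_sym (negPf ji) scale0r.
have h_surj : limg (linfun h) = fullv.
  apply/eqP; rewrite eqEsubv subvf -u_span; apply/span_subvP => _ /tnthP[i ->].
  by rewrite (tnth_nth 0) -he -lfunE memv_img ?memvf.
have dim_ker : \dim (lker p) = \dim (lker (linfun h)).
  have := limg_ker_dim p fullv; rewrite -(limg_ker_dim (linfun h) fullv).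
  by rewrite !capfv p_surj h_surj => /addIn.
pose X := vbasis (lker (linfun h)); pose Y := vbasis (lker p).
(* [coord X] is linear on all of [V]. Injectivity of [a] only involves [k] on the kernel of [h];
   elsewhere it suffices that [k] takes values in the kernel of [p]. *)
pose k v := \sum_i coord X i v *: Y`_i.
have pk v : p (k v) = 0.
  apply/eqP; rewrite -memv_ker; apply: memv_suml => i _; apply/memvZ/vbasis_mem.
  by rewrite mem_nth // size_tuple dim_ker.
have a_lin : linear (fun v => p^-1%VF (h v) + k v).
  move=> c x y; rewrite !linearP /k scalerDr addrACA; congr (_ + _).
  rewrite scaler_sumr -big_split; apply: eq_bigr => i _.
  by rewrite linearP scalerDl scalerA.
pose aM := GRing.isLinear.Build _ _ _ _ _ a_lin.
pose a : {linear V -> V} := HB.pack (fun v => p^-1%VF (h v) + k v) aM.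
have pa v : p (a v) = h v.
  by rewrite linearD /= pk addr0 limg_lfunVK // p_surj memvf.
have a_inj : lker (linfun a) == 0%VS.
  rewrite -subv0; apply/subvP => v; rewrite memv_ker lfunE memv0 => /eqP av0.
  have hv0 : h v = 0 by rewrite -pa av0 linear0.
  have kerv : v \in lker (linfun h) by rewrite memv_ker lfunE hv0.
  have kv0 : k v = 0 by move: av0; rewrite -[a v]/(_ + _) hv0 linear0 add0r.
  rewrite (coord_vbasis kerv) big1 // => i _; rewrite -/X.
  have Y_free : free Y := basis_free (vbasisP _).
  have /freeP Y_free' : free (tcast dim_ker Y) by rewrite val_tcast.
  rewrite (Y_free' (fun i => coord X i v)) ?scale0r // -[RHS]kv0.
  by apply: eq_bigr => j _; rewrite val_tcast.
exists [tuple of map (linfun a) e].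
  have := @limg_basis_of _ _ _ (linfun a) _ _ _ (vbasisP fullv).
  by rewrite (eqP a_inj) capv0 (lker0_limgf a_inj); apply.
(* [i] is any natural number; past the end both sides are the default [0]. *)
move=> i; have [lt_i | ge_i] := ltnP i (\dim {:V}); last first.
  by rewrite !nth_default ?linear0 ?size_tuple.
by rewrite (nth_map 0) ?size_tuple // lfunE pa (he (Ordinal lt_i)).
Qed.

(** * Subspaces over the small field that define subgeometries *)

Section SpanningSubspaces.

Variables (F : fieldType) (K : fieldExtType F) (V : vectType K).
Implicit Types (W : {vspace restr V}) (v w : V).

Lemma sum_restrE n (a : 'I_n -> F) (x : 'I_n -> V) :
  \sum_i a i *: (x i : restr V) = \sum_i (a i)%:A *: x i.
Proof. by []. Qed.

Lemma inj_in_alg : injective (in_alg K).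
Proof. exact: fmorph_inj. Qed.

Lemma free_restr n (x : n.-tuple V) : free x -> free (x : n.-tuple (restr V)).
Proof.
move=> /freeP x_free; apply/freeP => a; rewrite sum_restrE => ax0 i.
by apply: inj_in_alg; rewrite rmorph0; apply: (x_free (fun i => (a i)%:A)).
Qed.

Lemma basis_Kspan W :
  \dim W = \dim {:V} -> Kspan W = fullv -> basis_of fullv (vbasis W : seq V).
Proof.
by move=> dimW spanW; rewrite basisEdim -dimW size_tuple leqnn andbT -spanW.
Qed.

Lemma free_vbasis_restr W :
  \dim W = \dim {:V} -> Kspan W = fullv -> free (vbasis W : seq V).
Proof. by move=> dimW spanW; apply/basis_free/basis_Kspan. Qed.

(** An [F]-basis of [W] is also a [K]-basis of [V], so the coordinates of [v] and [c *: v] are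
    unique and lie in [F]; [c] is their quotient at a nonzero coordinate of [v]. *)
Lemma mem_scale_restr W v c :
    \dim W = \dim {:V} -> Kspan W = fullv -> v != 0 ->
    (v : restr V) \in W -> (c *: v : restr V) \in W ->
  exists a : F, c = a%:A.
Proof.
move=> dimW spanW nz_v Wv Wcv; pose e := vbasis W.
have /freeP e_free := free_vbasis_restr dimW spanW.
pose x := coord e ^~ v; pose y := coord e ^~ (c *: v : restr V).
have cxy i : c * (x i)%:A = (y i)%:A.
  apply/eqP; rewrite -subr_eq0; apply/eqP.
  apply: (e_free (fun i => c * (x i)%:A - (y i)%:A)).
  under eq_bigr do rewrite scalerBl -scalerA.
  have vE : v = \sum_i (x i)%:A *: (e`_i : V) := coord_vbasis Wv.
  have cvE : c *: v = \sum_i (y i)%:A *: (e`_i : V) := coord_vbasis Wcv.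
  by rewrite sumrB -scaler_sumr -vE -cvE subrr.
have [i nz_xi | x0] := pickP (fun i => x i != 0).
  exists (y i / x i); rewrite -in_algE fmorph_div /= -cxy mulfK //.
  by rewrite -in_algE fmorph_eq0.
case/eqP: nz_v; rewrite (coord_vbasis Wv) big1 // => i _.
by have /negbFE/eqP := x0 i; rewrite -/e -/(x i) => ->; rewrite scale0r.
Qed.

(** An [F]-basis of [U] spans [R] over [K] and has as many members as a [K]-basis of [V], so
    [lift_basis] applies. [W] is the [F]-span of the lifts, and [p] matches the two [F]-bases. *)
Lemma lift_spanning_subspace (R : vectType K) (p : 'Hom(V, R))
    (U : {vspace restr R}) :
    limg p = fullv -> \dim U = \dim {:V} -> Kspan U = fullv ->
  exists W : {vspace restr V},
    [/\ \dim W = \dim {:V}, Kspan W = fullv,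
        forall w, (w : restr V) \in W -> (p w : restr R) \in U,
        forall w, (w : restr V) \in W -> p w = 0 -> w = 0 &
        forall u : R, (u : restr R) \in U ->
          exists2 w : V, (w : restr V) \in W & p w = u].
Proof.
move=> p_surj dimU; rewrite /Kspan; move: (vbasis U) (vbasisP U).
rewrite dimU => u U_u u_span.
have [w w_basis pw] := lift_basis p_surj u_span.
have wF_free := free_restr (basis_free w_basis).
pose wF : (\dim {:V}).-tuple (restr V) := w.
pose W : {vspace restr V} := <<wF>>%VS.
have W_basis : basis_of W wF by rewrite /basis_of eqxx.
have pW (x : 'I_(\dim {:V}) -> F) :
    p (\sum_i x i *: wF`_i) = \sum_i x i *: (u`_i : restr R).
  rewrite sum_restrE linear_sum; apply: eq_bigr => i _.
  by rewrite linearZ /= pw.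
exists W; split.
- exact: size_basis W_basis.
- apply/eqP; rewrite eqEsubv subvf -(span_basis w_basis).
  apply/span_subvP => v wv; rewrite -mem_restrv.
  have /subvP : (W <= restrv (Kspan W))%VS by rewrite -Kspan_subv subvv.
  by apply; apply: memv_span.
- move=> v /(coord_basis W_basis) ->; rewrite pW.
  apply: memv_suml => i _; apply/memvZ/(basis_mem U_u)/mem_nth.
  by rewrite size_tuple.
- move=> v /(coord_basis W_basis) ->; rewrite pW => x0.
  have /freeP/(_ _ x0) x0' := basis_free U_u.
  by rewrite big1 // => i _; rewrite x0' scale0r.
move=> v /(coord_basis U_u) ->; exists (\sum_i coord u i v *: wF`_i).
  apply: memv_suml => i _; apply/memvZ/memv_span/mem_nth.
  by rewrite size_tuple.
exact: pW.
Qed.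

End SpanningSubspaces.

(* The image of a subgeometry determines the image of its defining subspace
   only up to a scalar, which is read off at the sum of a basis. *)
Lemma semilinear_subgeometry (F : finFieldType) (K : fieldExtType F)
    (V : vectType K) (s : {rmorphism K -> K}) (f : V -> V)
    (W1 W2 : {vspace restr V}) :
    semilinear s f ->
    \dim W1 = \dim {:V} -> Kspan W1 = fullv -> \dim W2 = \dim {:V} ->
    (forall w : V, (w : restr V) \in W1 ->
       exists (c : K) (z : V), [/\ c != 0, (z : restr V) \in W2 & f w = c *: z]) ->
  exists2 d, d != 0 &
    forall w : V, (w : restr V) \in W1 -> (d *: f w : restr V) \in W2.
Proof.
move=> sl_f dimW1 spanW1 dimW2 fW; pose e := vbasis W1.
have [s0 [_ sE]] := rmorphism_base_field s.
case: (sl_f) => -[s' sK s'K] _ _ fZ.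
have We i : e`_i \in W1.
  have [lt_i | ge_i] := ltnP i (size e); first by rewrite vbasis_mem ?mem_nth.
  by rewrite nth_default ?mem0v.
have /freeP e_free := free_vbasis_restr dimW1 spanW1.
have cy_ex (i : 'I_(\dim W1)) : {cz : K * V |
    [/\ cz.1 != 0, (cz.2 : restr V) \in W2 & f e`_i = cz.1 *: cz.2]}.
  by apply: cid; have [c [z cz]] := fW _ (We i); exists (c, z).
pose c i := (sval (cy_ex i)).1; pose y i := (sval (cy_ex i)).2.
have cyP i : [/\ c i != 0, (y i : restr V) \in W2 & f e`_i = c i *: y i].
  exact: svalP (cy_ex i).
(* A [K]-relation among the [y i] pulls back along [f], after division by [c i] and transport by
   [s'], to a relation in the [K]-basis [e]. *)
have y_free (x : 'I_(\dim W1) -> K) : \sum_i x i *: y i = 0 -> forall i, x i = 0.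
  move=> xy0 i; have [nz_c _ _] := cyP i.
  have x'0 : \sum_i s' (x i / c i) *: (e`_i : V) = 0.
    apply/eqP; rewrite -(semilinear_eq0 sl_f) (semilinear_sum sl_f) -[X in _ == X]xy0.
    apply/eqP/eq_bigr => j _; have [nz_cj _ fe] := cyP j.
    by rewrite fZ s'K fe scalerA divfK.
  have := e_free (fun i => s' (x i / c i)) x'0 i.
  move/(congr1 s); rewrite s'K rmorph0 => /eqP.
  by rewrite mulf_eq0 invr_eq0 (negPf nz_c) orbF => /eqP.
pose Y : (\dim W1).-tuple V := [tuple y i | i < \dim W1].
have Y_nth (i : 'I_(\dim W1)) : Y`_i = y i by rewrite -tnth_nth tnth_mktuple.
have leq_dim : (\dim W2 <= \dim W1)%N by rewrite dimW1 dimW2.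
have Y_basis : basis_of W2 (Y : (\dim W1).-tuple (restr V)).
  rewrite basisEfree size_tuple leq_dim andbT; apply/andP; split.
    apply/free_restr/freeP => x xy0; apply: y_free; rewrite -[RHS]xy0.
    by apply: eq_bigr => i _; rewrite Y_nth.
  by apply/span_subvP => _ /tnthP[i ->]; rewrite tnth_mktuple; case: (cyP i).
have [d [z [nz_d Wz fz]]] : exists (c : K) (z : V),
    [/\ c != 0, (z : restr V) \in W2 & f (\sum_(i < \dim W1) e`_i : restr V) = c *: z].
  by apply/fW/memv_suml.
pose a := coord (Y : (\dim W1).-tuple (restr V)) ^~ (z : restr V).
(* The image of the sum of the basis is both the sum of the [c i *: y i] and [d *: z], where [z] has
   coordinates [a i] in [F]; the [y i] being independent over [K], coefficients agree. *)
have cE i : c i = d * (a i)%:A.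
  apply/eqP; rewrite -subr_eq0; apply/eqP.
  apply: (y_free (fun i => c i - d * (a i)%:A)).
  under eq_bigr do rewrite scalerBl -scalerA.
  rewrite sumrB -scaler_sumr; apply/eqP; rewrite subr_eq0; apply/eqP.
  transitivity (f (\sum_(i < \dim W1) e`_i : restr V)).
    by rewrite (semilinear_sum sl_f); apply: eq_bigr => j _; case: (cyP j).
  rewrite fz (coord_basis Y_basis Wz); congr (_ *: _); apply: eq_bigr => j _.
  by rewrite -Y_nth.
(* Division by [d] brings the images of the basis vectors into [W2], and [s] keeps coefficients in
   [F]. *)
exists d^-1; first by rewrite invr_eq0.
move=> w /coord_vbasis ->; rewrite sum_restrE (semilinear_sum sl_f) scaler_sumr.
apply: (@memv_suml _ (restr V)) => i _; have [_ Wy fe] := cyP i.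
rewrite fZ sE fe cE.
set b := (s0 _)%:A; set a_i := (a i)%:A.
have -> : d^-1 *: (b *: ((d * a_i) *: y i)) = b *: (a_i *: y i).
  by rewrite !scalerA [d^-1 * b]mulrC -!mulrA mulKf.
exact/(@memvZ _ (restr V))/(@memvZ _ (restr V)).
Qed.

(** * Projection onto [Lam] from its fixed complement *)

Section Projection.

Variables (F : fieldType) (K : fieldExtType F).

Lemma calBP (R : vectType K) (S : {vspace restr R}) (P : pgpoint R) :
  calB S P <-> exists u : R, [/\ u != 0, (u : restr R) \in S & u \in val P].
Proof.
split=> [[Q [QP QS]] | [u [nz_u Su Pu]]].
  have [u nz_u defQ] := pgpointP Q; exists u; split=> //.
    by move: QS; rewrite /PG /= defQ -memvE.
  by rewrite -mem_restrv memvE -defQ.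
have [Q defQ] := @line_pgpoint _ (restr R) _ nz_u.
by exists Q; split; rewrite /PG /= defQ -memvE // mem_restrv.
Qed.

(** Each point of [calB S] is spanned by a nonzero vector of [S], hence lies in [Kspan S]. *)
Lemma Kspan_calB (R : vectType K) (S : {vspace restr R}) :
  pspan (calB S) = [set: pgpoint R] -> Kspan S = fullv.
Proof.
move=> spanS; apply: (pspan_full spanS) => P /calBP[u [nz_u Su Pu]].
rewrite /PG /= (pgpoint_line Pu nz_u) -memvE -mem_restrv.
by have /subvP : (S <= restrv (Kspan S))%VS by [rewrite -Kspan_subv subvv]; apply.
Qed.

Variables (V : vectType K) (Lam : {vspace V}).
Let R := subvs_of Lam.
Let p : 'Hom(V, R) := linfun (vsproj Lam).

Lemma linfun_vsproj_surj : limg p = fullv.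
Proof.
apply/eqP; rewrite eqEsubv subvf; apply/subvP => x _.
by rewrite -(vsvalK x) -lfunE memv_img ?memvf.
Qed.

Lemma linfun_vsproj_eq0 v : (p v == 0) = (v \in (Lam^C)%VS).
Proof.
by rewrite -lker_proj memv_ker lfunE -(inj_eq val_inj) /= unlock.
Qed.

Lemma linfun_vsprojK x : p (vsval x) = x.
Proof. by rewrite lfunE; apply: vsvalK. Qed.

Definition subgeometry (W : {vspace restr V}) : set (pgpoint V) :=
  [set P | exists w : V,
     [/\ w != 0, (w : restr V) \in W & val P = <[w]>%VS]].

(** A vector and its projection onto [Lam] differ by an element of [Lam^C]. This identifies the
    geometric projection from [Lam^C] with the linear map [p]. *)
Lemma compl_line_cap w :
  ((Lam^C + <[w]>) :&: Lam = linfun vsval @: <[p w]>)%VS.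
Proof.
have projE v : projv Lam v = vsval (p v) by rewrite lfunE /= [vsproj _]unlock.
rewrite limg_line lfunE /= -projE; apply/vspaceP => x.
apply/memv_capP/vlineP => [[/memv_addP[g Cg [_ /vlineP[c ->] ->]] Lx] | [c ->]].
  exists c; rewrite -[LHS](projv_id Lx) linearD linearZ /=.
  by rewrite projE (eqP (etrans (linfun_vsproj_eq0 g) Cg)) linear0 add0r.
split; last by rewrite memvZ ?memv_proj.
have -> : c *: projv Lam w = c *: - (w - projv Lam w) + c *: w.
  by rewrite -scalerDr opprB subrK.
by rewrite memv_add ?memvZ ?memv_line ?memvN ?memv_projC.
Qed.

Variables (W : {vspace restr V}) (U : {vspace restr R}).
Hypotheses
  (pWU : forall w : V, (w : restr V) \in W -> (p w : restr R) \in U)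
  (pW0 : forall w : V, (w : restr V) \in W -> p w = 0 -> w = 0)
  (pWU_surj : forall u : R, (u : restr R) \in U ->
     exists2 w : V, (w : restr V) \in W & p w = u).

Lemma projection_subgeometry : projection (Lam^C)%VS (subgeometry W) = calB U.
Proof.
have lker_val : lker (linfun (vsval : R -> V)) == 0%VS.
  by apply/lker0P => x y; rewrite !lfunE /=; apply: val_inj.
have valE (Q : pgpoint R) w : (linfun vsval @: val Q == (Lam^C + <[w]>) :&: Lam)%VS
    = (val Q == <[p w]>%VS).
  by rewrite compl_line_cap eq_limg_ker0.
apply/seteqP; split=> [Q [P [w [nz_w Ww ->]] /eqP] | Q /calBP[u [+ /pWU_surj[w Ww pw]]]];
  last rewrite -pw => nz_pw Qpw.
  rewrite valE => /eqP defQ; apply/calBP; exists (p w); split.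
  - by apply: contraNneq nz_w => /pW0 ->.
  - exact: pWU.
  by rewrite defQ memv_line.
have nz_w : w != 0 by apply: contraNneq nz_pw => ->; rewrite linear0.
have [P defP] := line_pgpoint nz_w; exists P; first by exists w.
by apply/eqP; rewrite defP valE (pgpoint_line Qpw nz_pw).
Qed.

Lemma subgeometry_disjoint : subgeometry W `<=` ~` PG (Lam^C)%VS.
Proof.
move=> P [w [nz_w Ww defP]]; rewrite /PG /= defP -memvE -linfun_vsproj_eq0.
by move=> /eqP /(pW0 Ww) w0; rewrite w0 eqxx in nz_w.
Qed.

End Projection.

(** * Descent of semilinear maps to [Lam] *)

Section Descent.

Variables (F : finFieldType) (K : fieldExtType F) (V : vectType K).
Variable Lam : {vspace V}.
Let R := subvs_of Lam.
Let p : 'Hom(V, R) := linfun (vsproj Lam).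

Variables (s : {rmorphism K -> K}) (f : V -> V).
Hypotheses (sl_f : semilinear s f)
  (fLam : forall v, (f v \in Lam^C)%VS = (v \in Lam^C)%VS).

(** The map that [f] induces on the quotient of [V] by [Lam^C], with [Lam] as a set of
    representatives. *)
Let g (x : R) : R := p (f (vsval x)).

(** Independence of the representative: [v] and [p v] differ by an element of [Lam^C], which [f]
    preserves and [p] kills. *)
Lemma descent_vsproj v : g (p v) = p (f v).
Proof.
apply/eqP; rewrite -subr_eq0 -linearB -(semilinearB sl_f).
rewrite linfun_vsproj_eq0 fLam -linfun_vsproj_eq0 linearB subr_eq0.
by apply/eqP/linfun_vsprojK.
Qed.

Lemma semilinear_descent : semilinear s g.
Proof.
case: (sl_f) => bij_s [f' fK f'K] fD fZ.
have g_surj x : {y | g y = x}.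
  by exists (p (f' (vsval x))); rewrite descent_vsproj f'K linfun_vsprojK.
have gD : {morph g : x y / x + y} by move=> x y; rewrite /g !linearD fD linearD.
have gZ a x : g (a *: x) = s a *: g x by rewrite /g linearZ fZ linearZ.
have g0 x : g x = 0 -> x = 0.
  move=> /eqP; rewrite -(linfun_vsprojK x) descent_vsproj.
  by rewrite linfun_vsproj_eq0 fLam -linfun_vsproj_eq0 => /eqP.
have gI : injective g.
  move=> x y eqg; apply/eqP; rewrite -subr_eq0; apply/eqP/g0.
  by rewrite gD -scaleN1r gZ rmorphN1 scaleN1r eqg subrr.
split=> //; exists (fun x => sval (g_surj x)) => x; last exact: (svalP (g_surj x)).
by apply: gI; apply: (svalP (g_surj (g x))).
Qed.

Lemma semilinear_restr (s0 : {rmorphism F -> F}) :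
    bijective s0 -> (forall a : F, s a%:A = (s0 a)%:A) ->
  semilinear s0 (g : restr R -> restr R).
Proof.
case: semilinear_descent => _ bij_g gD gZ bij_s0 sE.
by split=> // a v; rewrite !restr_scaleE gZ sE.
Qed.

(** [gamma] and [h] come from the one map [g], read over [F] and over [K], so [gamma] sends the
    spread element of [P] to that of [h P]; since [h] is onto, every spread element is reached. *)
Lemma descent_collineation (U U' : {vspace restr R}) :
    (forall u : R, ((g u : restr R) \in U') = ((u : restr R) \in U)) ->
  exists gamma : pgpoint (restr R) -> pgpoint (restr R),
    [/\ collineation gamma,
        gamma @` PG U = PG U',
        [set gamma @` D | D in @desarguesian_spread F K R] =
          @desarguesian_spread F K R &
        exists2 h : pgpoint R -> pgpoint R, collineation h &
          forall P, gamma @` PG (field_reduction P) = PG (field_reduction (h P))].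
Proof.
move=> gU; have [s0 [bij_s0 sE]] := rmorphism_base_field s.
have sl_g := semilinear_descent; have sl_g0 := semilinear_restr bij_s0 sE.
have [gamma gammaE] := semilinear_induces sl_g0.
have [h hE] := semilinear_induces sl_g.
have gammah P : gamma @` PG (field_reduction P) = PG (field_reduction (h P)).
  apply/(induced_image_PG sl_g0 gammaE) => v; rewrite !mem_restrv.
  exact: (mem_induced sl_g hE).
exists gamma; split.
- exact (induced_collineation sl_g0 gammaE).
- exact/(induced_image_PG sl_g0 gammaE).
- apply/seteqP; split=> [_ [_ [P _ <-] <-] | _ [Q _ <-]].
    by rewrite gammah; exists (h P).
  have [P <-] := induced_surj sl_g hE Q.
  by exists (PG (field_reduction P)); rewrite ?gammah //; exists P.
by exists h; first exact (induced_collineation sl_g hE).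
Qed.

End Descent.

(** * Condition (A) deduced from collineations fixing the centre *)

Theorem theorem5p5 (q t n r : nat) (F : finFieldType) (K : fieldExtType F)
    (hF : #|F| = q) (hK : \dim {:K} = t)
    (V : vectType K) (Lam : {vspace V})
    (hV : \dim {:V} = n) (hLam : \dim Lam = r)
    (L : set (pgpoint (subvs_of Lam)))
    (hL : linear_set n L) (hspan : pspan L = [set: pgpoint (subvs_of Lam)])
    (hA : ~ conditionA n L) :
  exists (Gam : {vspace V}) (Sigma1 Sigma2 : set (pgpoint V)),
    [/\ \dim Gam = (n - r)%N /\ PG Gam `&` PG Lam = set0,
        canonical_subgeometry Sigma1 /\ canonical_subgeometry Sigma2,
        Sigma1 `<=` ~` PG Gam /\ Sigma2 `<=` ~` PG Gam,
        L = projection Gam Sigma1 /\ L = projection Gam Sigma2 &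
        ~ exists beta : pgpoint V -> pgpoint V,
            [/\ collineation beta, beta @` Sigma1 = Sigma2 &
                beta @` PG Gam = PG Gam]].
Proof.
apply: contrapT => noG; apply: hA => U U' dimU dimU' calU calU'.
pose p : 'Hom(V, subvs_of Lam) := linfun (vsproj Lam).
have spanU : Kspan U = fullv by apply: Kspan_calB; rewrite calU.
have spanU' : Kspan U' = fullv by apply: Kspan_calB; rewrite calU'.
rewrite -hV in dimU dimU'.
have p_surj : limg p = fullv := linfun_vsproj_surj Lam.
have [W [dimW spanW pW pW0 pW_surj]] :=
  lift_spanning_subspace p_surj dimU spanU.
have [W' [dimW' spanW' pW' pW'0 pW'_surj]] :=
  lift_spanning_subspace p_surj dimU' spanU'.
(* Without such a [beta], [Lam^C] and the subgeometries of [W] and [W'] would form the configuration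
   excluded by [noG]. *)
have [beta [[s [f [bij_s bij_f fD fZ fbeta]]] betaW betaG]] :
    exists beta : pgpoint V -> pgpoint V,
    [/\ collineation beta, beta @` subgeometry W = subgeometry W' &
        beta @` PG (Lam^C)%VS = PG (Lam^C)%VS].
  apply: contrapT => noB; apply: noG.
  exists (Lam^C)%VS, (subgeometry W), (subgeometry W'); split=> //.
  - split; first by rewrite dimv_compl hV hLam.
    apply/seteqP; split=> // P [PC PL]; have [v nz_v defP] := pgpointP P.
    have : v \in (Lam :&: Lam^C)%VS.
      by move: PC PL; rewrite /PG /= defP -!memvE memv_cap => -> ->.
    by rewrite capv_compl memv0 (negPf nz_v).
  - by split; [exists W | exists W'].
  - by split; apply: subgeometry_disjoint.
  split; symmetry; first by rewrite -calU; apply: projection_subgeometry.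
  by rewrite -calU'; apply: projection_subgeometry.
have sl_f : semilinear s f by [].
have fLam := (induced_image_PG sl_f fbeta _ _).1 betaG.
have fW (w : V) : (w : restr V) \in W ->
    exists (c : K) (z : V), [/\ c != 0, (z : restr V) \in W' & f w = c *: z].
  move=> Ww; have [->|nz_w] := eqVneq w 0.
    by exists 1, 0; rewrite oner_eq0 (semilinear0 sl_f) scaler0 mem0v.
  have [P defP] := line_pgpoint nz_w.
  have [z [nz_z Wz defQ]] : subgeometry W' (beta P).
    by rewrite -betaW; exists P => //; exists w.
  have /vlineP[c fwE] : f w \in <[z]>%VS.
    by rewrite -defQ fbeta // defP memv_line.
  exists c, z; split=> //; apply: contraNneq nz_w => c0.
  by rewrite -(semilinear_eq0 sl_f) fwE c0 scale0r.
have [d nz_d dfW] := semilinear_subgeometry sl_f dimW spanW dimW' fW.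
(* Rescaling leaves the point map unchanged, but [f'] carries [W] into [W'] itself. *)
pose f' v := d *: f v; have sl_f' : semilinear s f' := semilinear_scale sl_f nz_d.
have f'Lam v : (f' v \in Lam^C)%VS = (v \in Lam^C)%VS by rewrite rpredZeq (negPf nz_d) /= fLam.
have gp v : p (f' (vsval (p v))) = p (f' v) := descent_vsproj sl_f' f'Lam v.
have g_inj : injective (fun x : subvs_of Lam => p (f' (vsval x))).
  by case: (semilinear_descent sl_f' f'Lam) => _ /bij_inj.
apply: (descent_collineation sl_f' f'Lam) => u; rewrite -/p.
apply/idP/idP => [|/pW_surj[w Ww <-]]; last by rewrite gp; apply/pW'/dfW.
(* The image of [u] lifts to [z] in [W'], and the point of [z] is the image of that of some [w] in
   [W]. So [f' w] is a multiple of [z]; as both lie in [W'], the factor is in [F] and can be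
   absorbed into [w]. *)
move=> /pW'_surj[z Wz pz].
have [z0|nz_z] := eqVneq z 0.
  suff -> : u = 0 by apply: mem0v.
  by apply: g_inj; rewrite -pz z0 linear0 (semilinear0 sl_f') linear0.
have [Q defQ] := line_pgpoint nz_z.
have [P [w [nz_w Ww defP]] defbP] : (beta @` subgeometry W) Q.
  by rewrite betaW; exists z.
have /vlineP[c f'wE] : f' w \in <[z]>%VS.
  by rewrite -defQ -defbP memvZ // fbeta // defP memv_line.
have nz_c : c != 0.
  apply: contraNneq nz_w => c0.
  by rewrite -(semilinear_eq0 sl_f') f'wE c0 scale0r.
have [a cE] : exists a : F, c = a%:A.
  by apply: (mem_scale_restr dimW' spanW' nz_z Wz); rewrite -f'wE; apply: dfW.
have [s0 [[s1 _ s1K] sE]] := rmorphism_base_field s.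
(* [s1] inverts the automorphism [s0] that [s] induces on [F], so [f'] turns the scalar [s1 a^-1]
   into [a^-1], which cancels [c]. *)
have f'z : f' ((s1 a^-1)%:A *: w) = z.
  case: sl_f' => _ _ _ ->; rewrite f'wE sE s1K cE scalerA mulr_algl.
  rewrite scalerK ?scale1r //; apply: contraNneq nz_c => a0.
  by rewrite cE a0 scale0r.
have -> : u = p ((s1 a^-1)%:A *: w) by apply: g_inj; rewrite gp f'z pz.
by apply: pW; apply: (@memvZ _ (restr V)).
Qed.
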